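(* Let $d\ge1$ and let $\rho:\mathbb{R}^d\to\mathbb{R}$ be a continuous stationary covariance function with $\rho(\boldsymbol{x})=\rho(|x_1|,\ldots,|x_d|)$ for all $\boldsymbol{x}\in\mathbb{R}^d$. For fixed $\ell\ge1$ and fixed $\boldsymbol{k}\in\{-m,\ldots,m-1\}^d$, where $m=\ell/h_0$, the matrix eigenvalues $\Lambda^{\rm ext}_{\boldsymbol{k}}(h_0,\ell)$, weighted by $h_0^d$, converge to $\lambda^{\rm ext}_{\boldsymbol{k}}(\ell)$ as $h_0\to0$: $$h_0^d\,\Lambda^{\rm ext}_{\boldsymbol{k}}(h_0,\ell)\to\lambda^{\rm ext}_{\boldsymbol{k}}(\ell)\qquad\text{as }h_0\to0 .$$
   Context: A stationary covariance function is a symmetric ($\rho(\boldsymbol{x})=\rho(-\boldsymbol{x})$), positive semidefinite function: $\sum_{i,i'}\gamma_i\gamma_{i'}\rho(\boldsymbol{t}_i-\boldsymbol{t}_{i'})\ge0$ for all finite point sets and real weights. Here $h_0=1/m_0$ with $m_0\ge 1$ an integer, and $h_0\to0$ through values for which $m=\ell/h_0$ is an integer (so a fixed $\boldsymbol{k}\in\mathbb{Z}^d$ lies in $\{-m,\ldots,m-1\}^d$ for all sufficiently small $h_0$). Let $\varphi:\mathbb{R}\to\mathbb{R}$ be the $2\ell$-periodic function with $\varphi(x)=x$ for $0\le x\le\ell$ and $\varphi(x)=2\ell-x$ for $\ell\le x<2\ell$, and $\rho^{\rm ext}(\boldsymbol{x})=\rho(\varphi(x_1),\ldots,\varphi(x_d))$.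 Matrix eigenvalues: $R^{\rm ext}$ is the $(2m)^d\times(2m)^d$ matrix $R^{\rm ext}_{\boldsymbol{k},\boldsymbol{k}'}=\rho^{\rm ext}(h_0(\boldsymbol{k}-\boldsymbol{k}'))$, $\boldsymbol{k},\boldsymbol{k}'\in\{0,\ldots,2m-1\}^d$, and its eigenvalues, indexed ($2m$-periodically in each component of $\boldsymbol k$), are $$\Lambda^{\rm ext}_{\boldsymbol{k}}(h_0,\ell)=\sum_{\boldsymbol{k}'\in\{-m,\ldots,m-1\}^d}\rho(h_0\boldsymbol{k}')\exp\left(-2\pi\mathrm{i}\,\frac{\boldsymbol{k}\cdot\boldsymbol{k}'}{2m}\right).$$ Continuous eigenvalues: $\lambda^{\rm ext}_{\boldsymbol{k}}(\ell)$, $\boldsymbol{k}\in\mathbb{Z}^d$, are the eigenvalues of the periodic covariance integral operator $v\mapsto\int_{[0,2\ell]^d}\rho^{\rm ext}(\cdot-\boldsymbol{x}')v(\boldsymbol{x}')\,\mathrm{d}\boldsymbol{x}'$ on $2\ell$-periodic continuous functions, with eigenfunctions $\exp(2\pi\mathrm{i}\,\boldsymbol{\xi}_{\boldsymbol{k}}\cdot\boldsymbol{x})$, namely $$\lambda^{\rm ext}_{\boldsymbol{k}}(\ell)=\int_{[-\ell,\ell]^d}\rho(\boldsymbol{x})\exp(-2\pi\mathrm{i}\,\boldsymbol{\xi}_{\boldsymbol{k}}\cdot\boldsymbol{x})\,\mathrm{d}\boldsymbol{x},\qquad\boldsymbol{\xi}_{\boldsymbol{k}}=\boldsymbol{k}/(2\ell).$$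 *)

(* Defs.v *)
From HB Require Import structures.
From mathcomp Require Import all_boot all_order all_algebra complex.
From mathcomp Require Import all_classical all_reals all_analysis.

Set Implicit Arguments.
Unset Strict Implicit.
Unset Printing Implicit Defensive.

Import Order.TTheory GRing.Theory Num.Theory numFieldNormedType.Exports.

Local Open Scope classical_set_scope.
Local Open Scope ring_scope.
Local Open Scope complex_scope.

(* R^d is 'rV[R]_d, except for integration: the product sigma-algebra of the
   library lives on d.-tuple R, so Lebesgue measure is built there, by iterating
   the binary product measure. *)
Section LebesgueTuple.
Context {R : realType}.

Definition tuple_cons n (p : measurableTypeR R * n.-tuple (measurableTypeR R)) :
    n.+1.-tuple (measurableTypeR R) :=
  [tuple of p.1 :: p.2].

Lemma measurable_tuple_cons n : measurable_fun [set: _] (@tuple_cons n).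
Proof. exact: measurable_cons. Qed.

Section Step.
Context n (mu : {sigma_finite_measure set (n.-tuple (measurableTypeR R)) -> \bar R}).

Definition lebesgue_cons : set (n.+1.-tuple (measurableTypeR R)) -> \bar R :=
  pushforward (lebesgue_measure \x mu)%E (@tuple_cons n).

Let lebesgue_cons0 : lebesgue_cons set0 = 0%E.
Proof. by rewrite /lebesgue_cons /pushforward preimage_set0 measure0. Qed.

Let lebesgue_cons_ge0 A : (0 <= lebesgue_cons A)%E.
Proof. exact: (measure_ge0 (lebesgue_measure \x mu)%E). Qed.

Let mcons A : measurable A -> measurable (@tuple_cons n @^-1` A).
Proof.
by move=> mA; rewrite -[X in measurable X]setTI; exact: measurable_tuple_cons.
Qed.

Let lebesgue_cons_sigma_additive : semi_sigma_additive lebesgue_cons.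
Proof.
move=> F mF tF mUF; rewrite /lebesgue_cons /pushforward preimage_bigcup.
apply: measure_semi_sigma_additive.
- by move=> i; exact: mcons.
- apply/trivIsetP => /= i j _ _ ij; rewrite -preimage_setI.
  by move/trivIsetP : tF => /(_ _ _ _ _ ij) ->//; rewrite preimage_set0.
- by rewrite -preimage_bigcup; exact: mcons.
Qed.

HB.instance Definition _ := isMeasure.Build _ _ _ lebesgue_cons
  lebesgue_cons0 lebesgue_cons_ge0 lebesgue_cons_sigma_additive.

Lemma lebesgue_cons_sigma_finite : sigma_finite [set: _] lebesgue_cons.
Proof.
have /sigma_finiteP[F [TF ndF Foo]] := sigma_finiteT (@lebesgue_measure R).
have /sigma_finiteP[G [TG ndG Goo]] := sigma_finiteT mu.
pose uncons (t : n.+1.-tuple (measurableTypeR R)) :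
    measurableTypeR R * n.-tuple (measurableTypeR R) :=
  (tnth t ord0, [tuple of behead t]).
have consK : cancel (@tuple_cons n) uncons.
  move=> [x t]; rewrite /uncons /tuple_cons /= (tnth_nth x) /=.
  by congr pair; apply: val_inj.
have muncons : measurable_fun [set: _] uncons.
  apply/measurable_fun_pair => /=; [exact: measurable_tnth|].
  exact: measurable_behead.
exists (fun i => uncons @^-1` (F i `*` G i)).
  apply/esym; rewrite -subTset => t _.
  have [i _ Fi] : (\bigcup_i F i) (uncons t).1 by rewrite -TF.
  have [j _ Gj] : (\bigcup_i G i) (uncons t).2 by rewrite -TG.
  exists (maxn i j) => //; split.
    by move: Fi; exact/subsetPset/ndF/leq_maxl.
  by move: Gj; exact/subsetPset/ndG/leq_maxr.
move=> i; have [mFi Fi] := Foo i; have [mGi Gi] := Goo i; split.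
  by rewrite -[X in measurable X]setTI; apply: muncons => //; exact: measurableX.
rewrite /lebesgue_cons /pushforward -comp_preimage.
rewrite (_ : uncons \o _ = id) ?preimage_id; last first.
  by apply/funext => p; exact: consK.
by rewrite product_measure1E// lte_mul_pinfty// ge0_fin_numE.
Qed.

HB.instance Definition _ :=
  Measure_isSigmaFinite.Build _ _ _ lebesgue_cons lebesgue_cons_sigma_finite.

End Step.

Fixpoint lebesgue_tuple n :
    {sigma_finite_measure set (n.-tuple (measurableTypeR R)) -> \bar R} :=
  match n with
  | 0 => dirac [tuple]
  | n'.+1 => lebesgue_cons (lebesgue_tuple n')
  end.

Lemma lebesgue_tuple_box n (a b : 'I_n -> R) : (forall i, a i <= b i) ->
  lebesgue_tuple n [set x | forall i, a i <= tnth x i <= b i] =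
  (\prod_(i < n) (b i - a i))%:E.
Proof.
elim: n => [|n IH] in a b * => ab.
  rewrite big_ord0 /= /dirac /= indicE mem_set//=.
  by case.
rewrite big_ord_recl /= /lebesgue_cons /pushforward.
set B := [set x : n.-tuple (measurableTypeR R) |
  forall i, a (lift ord0 i) <= tnth x i <= b (lift ord0 i)].
rewrite [X in product_measure1 _ _ X](_ : _ =
    ([set` `[a ord0, b ord0]] : set (measurableTypeR R)) `*` B).
  rewrite product_measure1E /=; first last.
  - rewrite (_ : B = \bigcap_(i in [set: 'I_n]) ((fun x => tnth x i) @^-1`
        ([set` `[a (lift ord0 i), b (lift ord0 i)]] : set (measurableTypeR R)))).
      apply: fin_bigcap_measurable => [|i _]; first exact: finite_finset.
      rewrite -[X in measurable X]setTI.
      by apply: measurable_tnth => //; exact: measurable_itv.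
    apply/seteqP; split => x /= Bx i; first by move=> _ /=; rewrite in_itv /=.
    by have /= := Bx i I; rewrite in_itv.
  - exact: measurable_itv.
  rewrite [X in (_ * X)%E]IH // EFinM; congr (_ * _)%E.
  rewrite lebesgue_measure_itv /= lte_fin lt_neqAle ab andbT.
  by case: eqVneq => //= ->; rewrite subrr.
apply/seteqP; split => [[x t] /= H|[x t] /= [xab H] i].
  split; first by have := H ord0; rewrite in_itv.
  by move=> i; have := H (lift ord0 i); rewrite tnthS.
by case: (unliftP ord0 i) => [j|] -> ; [rewrite tnthS; exact: H|rewrite in_itv in xab].
Qed.

End LebesgueTuple.

Section CirculantEmbedding.
Context {R : realType}.

Definition dot {S : pzRingType} {d : nat} (u v : 'rV[S]_d) : S :=
  \sum_i u 0 i * v 0 i.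

Definition expi (t : R) : R[i] := cos t +i* sin t.

Definition stationary_covariance {d : nat} (rho : 'rV[R]_d -> R) : Prop :=
  (forall x, rho (- x) = rho x) /\
  (forall (n : nat) (t : 'I_n -> 'rV[R]_d) (g : 'I_n -> R),
     0 <= \sum_i \sum_j g i * g j * rho (t i - t j)).

(* The integral of a complex-valued function over [-l, l]^d. *)
Definition cube_integral {d : nat} (l : R) (f : 'rV[R]_d -> R[i]) : R[i] :=
  let cube := [set x : d.-tuple (measurableTypeR R) |
                forall i, - l <= tnth x i <= l] in
  let row (x : d.-tuple (measurableTypeR R)) : 'rV[R]_d := \row_i tnth x i in
  (\int[lebesgue_tuple d]_(x in cube) complex.Re (f (row x))) +i*
  (\int[lebesgue_tuple d]_(x in cube) complex.Im (f (row x))).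

Definition xi {d : nat} (l : R) (k : 'rV[int]_d) : 'rV[R]_d :=
  (2 * l)^-1 *: map_mx intr k.

Definition lambda_ext {d : nat} (rho : 'rV[R]_d -> R) (l : R)
    (k : 'rV[int]_d) : R[i] :=
  cube_integral l (fun x => (rho x)%:C * expi (- (2 * pi * dot (xi l k) x))).

(* As j ranges over {0, ..., 2m-1}^d, this ranges over {-m, ..., m-1}^d. *)
Definition centered {d : nat} (m : nat) (j : {ffun 'I_d -> 'I_(2 * m)}) :
    'rV[int]_d :=
  \row_i ((j i)%:Z - m%:Z).

Definition Lambda_ext {d : nat} (rho : 'rV[R]_d -> R) (h0 l : R)
    (k : 'rV[int]_d) : R[i] :=
  (* equal to l / h0 whenever that quotient is a natural number *)
  let m := Num.truncn (l / h0) in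
  \sum_(j : {ffun 'I_d -> 'I_(2 * m)})
    let k' := centered j in
    (rho (h0 *: map_mx intr k'))%:C *
    expi (- (2 * pi * ((dot k k')%:~R / (2 * m)%:R))).

Definition admissible_mesh (l : R) : set R :=
  [set h0 | (exists2 m0 : nat, (0 < m0)%N & h0 = m0%:R^-1) /\
            (exists m : nat, l / h0 = m%:R)].

End CirculantEmbedding.

(* Main.v *)
Require Import Defs.
From HB Require Import structures.
From mathcomp Require Import all_boot all_order all_algebra complex.
From mathcomp Require Import all_classical all_reals all_analysis.
From mathcomp Require Import measurable_realfun.
From mathcomp Require Import ring lra.

Set Implicit Arguments.
Unset Strict Implicit.
Unset Printing Implicit Defensive.

Import Order.TTheory GRing.Theory Num.Theory numFieldNormedType.Exports.

Local Open Scope classical_set_scope.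
Local Open Scope ring_scope.
Local Open Scope complex_scope.

(** With m = l / h0 the exponent of the j-th term of the eigenvalue sum is the
    phase of the continuous kernel evaluated at the grid point h0 k'
    ([phase_grid_point]): since xi_k = k / (2 l) and h0 = l / m,
    xi_k . (h0 k') = (k . k') / (2 m).  Hence h0^d Lambda_k is the Riemann sum,
    over the lower corners of a uniform grid of step h0 on the cube [-l, l]^d,
    of the integrand of lambda_k, which is continuous.

    Convergence of the Riemann sums of a continuous F ([riemann_sum_cvg]) is
    obtained by dominated convergence.  The cube is partitioned exactly into
    (2 m)^d boxes of volume h0^d, so that the Riemann sum is the integral of
    the step function equal on each box to the value of F at its corner
    ([integral_step]).  A point of the cube is within h0 of the corner of its
    box, so the step functions converge pointwise to F ([step_cvg]); they are
    bounded by the maximum of |F| on the compact cube.  This also yields the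
    measurability of F on tuples, whose sigma-algebra is defined without
    reference to the topology of R^d.

    The theorem follows by applying this to the real and imaginary parts
    rho cos and rho sin of the integrand, and by noting that m = l / h0 tends
    to infinity as h0 tends to 0 along the admissible steps
    ([cvg_truncn_mesh]). *)

(** * Product sets under the Lebesgue measure on tuples *)

Lemma measurable_tuple_box (R : realType) n
    (A : 'I_n -> set (measurableTypeR R)) :
  (forall i, measurable (A i)) ->
  measurable [set x : n.-tuple (measurableTypeR R) | forall i, A i (tnth x i)].
Proof.
move=> mA; rewrite (_ : mkset _ =
    \bigcap_(i in [set: 'I_n]) ((fun x => tnth x i) @^-1` A i)).
  apply: fin_bigcap_measurable => [|i _]; first exact: finite_finset.
  rewrite -[X in measurable X]setTI.
  by apply: measurable_tnth => //; exact: mA.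
by apply/seteqP; split => x Ax i; [move=> _; exact: Ax|exact: (Ax i I)].
Qed.

(** Induction on the dimension: the measure in dimension n + 1 is by definition
    the image of a binary product measure, under which the set is a rectangle. *)
Lemma lebesgue_tuple_prod (R : realType) n
    (A : 'I_n -> set (measurableTypeR R)) (a : 'I_n -> R) :
  (forall i, measurable (A i)) ->
  (forall i, lebesgue_measure (A i) = (a i)%:E) ->
  lebesgue_tuple n [set x | forall i, A i (tnth x i)] = (\prod_i a i)%:E.
Proof.
elim: n => [|n IH] in A a * => mA Aa.
  rewrite big_ord0 /= /dirac /= indicE mem_set//=.
  by case.
rewrite big_ord_recl /= /lebesgue_cons /pushforward.
set B := [set x : n.-tuple (measurableTypeR R) |
  forall i, A (lift ord0 i) (tnth x i)].
rewrite [X in product_measure1 _ _ X](_ : _ = A ord0 `*` B).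
  rewrite product_measure1E /=; [|exact: mA|].
    rewrite EFinM; congr (_ * _)%E; [exact: Aa|].
    apply: (IH (A \o lift ord0) (a \o lift ord0)) => i; [exact: mA|exact: Aa].
  by apply: (measurable_tuple_box (A := A \o lift ord0)) => i; exact: mA.
apply/seteqP; split => [[x t] /= H|[x t] /= [Ax H] i].
  split; first by have := H ord0.
  by move=> i; have := H (lift ord0 i); rewrite tnthS.
by case: (unliftP ord0 i) => [j|] ->//; rewrite tnthS; exact: H.
Qed.

(** * Partition of [-l, l] into 2 (m + 1) cells of equal length *)

Section Grid.
Context {R : realType}.
Variables (l : R) (m : nat).
Hypothesis l_gt0 : 0 < l.

(** The number of subdivisions is m + 1, which keeps the step meaningful for
    every m : nat. *)
Definition mesh : R := l / m.+1%:R.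

Definition node (i : nat) : R := mesh * (i%:R - m.+1%:R).

(** Cells are closed on the left and open on the right, except the last one,
    which is closed: they then partition the closed segment with no null set
    left over. *)
Definition cell (i : nat) : interval R :=
  Interval (BLeft (node i)) (BSide (i.+1 < 2 * m.+1)%N (node i.+1)).

(** On [-l, l] the minimum only acts at t = l, which the truncation would
    send one past the last cell. *)
Definition cell_index (t : R) : nat :=
  minn (Num.truncn ((t + l) / mesh)) (2 * m.+1).-1.

Lemma mesh_gt0 : 0 < mesh.
Proof. by rewrite divr_gt0// ltr0n. Qed.

Lemma cell_index_subproof t : (cell_index t < 2 * m.+1)%N.
Proof. by rewrite (leq_ltn_trans (geq_minr _ _))// prednK// muln_gt0. Qed.

Lemma node0 : node 0 = - l.
Proof. by rewrite /node sub0r mulrN /mesh divfK// pnatr_eq0. Qed.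

Lemma node_last : node (2 * m.+1) = l.
Proof.
by rewrite /node natrM mulr_natl mulr2n addrK /mesh divfK// pnatr_eq0.
Qed.

Lemma node_le : {homo node : i j / (i <= j)%N >-> i <= j}.
Proof.
by move=> i j ij; rewrite ler_pM2l ?mesh_gt0// lerD2r ler_nat.
Qed.

Lemma node_width i : node i.+1 - node i = mesh.
Proof. by rewrite /node -[i.+1%:R]natr1; ring. Qed.

Lemma scaled_ge i t : (i%:R <= (t + l) / mesh) = (node i <= t).
Proof.
rewrite ler_pdivlMr ?mesh_gt0// /node mulrBr lerBlDr mulrC.
by rewrite [mesh * m.+1%:R]divfK ?pnatr_eq0.
Qed.

(** The cells partition [-l, l]: the cell containing t is determined by the
    integer part of (t + l) / mesh. *)
Lemma cellP t (i : nat) : - l <= t <= l -> (i < 2 * m.+1)%N ->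
  (t \in cell i) = (cell_index t == i).
Proof.
move=> /andP[lt tl] iN.
have u0 : 0 <= (t + l) / mesh by rewrite -[0]/(0%:R) scaled_ge node0.
rewrite itv_boundlr /= bnd_simp.
have [iN1|] := ltnP i.+1 (2 * m.+1).
  rewrite /cell_index bnd_simp [t < _]ltNge -!scaled_ge.
  rewrite -ltNge -truncn_eq //.
  have iN2 : (i < (2 * m.+1).-1)%N by rewrite -ltnS prednK.
  rewrite /minn; case: ltnP => // ub.
  by rewrite !gtn_eqF// (leq_trans iN2).
rewrite bnd_simp => Ni.
have {}Ni : i.+1 = (2 * m.+1)%N by apply/eqP; rewrite eqn_leq iN.
rewrite Ni node_last tl andbT -scaled_ge -truncn_ge_nat//.
by rewrite /cell_index -Ni /= eqn_leq geq_minr leq_min leqnn andbT.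
Qed.

Lemma cell_sub t i : (i < 2 * m.+1)%N -> t \in cell i -> - l <= t <= l.
Proof.
move=> iN; rewrite itv_boundlr /= bnd_simp => /andP[it ti].
rewrite -node0 -node_last (le_trans (node_le (leq0n i)) it)//=.
apply: le_trans (node_le iN).
by move: ti; case: ltnP => _; rewrite bnd_simp// => /ltW.
Qed.

Lemma lebesgue_measure_cell i : lebesgue_measure [set` cell i] = mesh%:E.
Proof.
rewrite lebesgue_measure_itv /= lte_fin -subr_gt0 node_width mesh_gt0.
by rewrite -(node_width i).
Qed.

Lemma cell_index_dist t : - l <= t <= l -> `|t - node (cell_index t)| <= mesh.
Proof.
move=> tl; have := cellP tl (cell_index_subproof t).
rewrite eqxx itv_boundlr /= bnd_simp => /andP[it ti].
rewrite ger0_norm ?subr_ge0// -(node_width (cell_index t)) lerD2r.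
by move: ti; case: ltnP => _; rewrite bnd_simp// => /ltW.
Qed.

Lemma node_cell_index_sub t : - l <= t <= l -> - l <= node (cell_index t) <= l.
Proof.
move=> tl; rewrite -node0 -node_last !node_le//.
exact: ltnW (cell_index_subproof t).
Qed.

End Grid.

(** * Riemann sums over the cube *)

Definition row_of_tuple (R : realType) d (x : d.-tuple (measurableTypeR R)) :
    'rV[R]_d :=
  \row_i tnth x i.

Definition cube (R : realType) d (l : R) : set (d.-tuple (measurableTypeR R)) :=
  [set x | forall i, - l <= tnth x i <= l].

Section RiemannSum.
Context {R : realType} (d : nat) (l : R) (F : 'rV[R]_d -> R).
Hypothesis l_gt0 : 0 < l.
Hypothesis F_cont : continuous F.

Definition grid_point m (j : {ffun 'I_d -> 'I_(2 * m)}) : 'rV[R]_d :=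
  (l / m%:R) *: map_mx intr (centered j).

Definition box m (j : {ffun 'I_d -> 'I_(2 * m.+1)}) :
    set (d.-tuple (measurableTypeR R)) :=
  [set x | forall i, [set` cell l m (j i)] (tnth x i)].

Definition box_index m (x : d.-tuple (measurableTypeR R)) :
    {ffun 'I_d -> 'I_(2 * m.+1)} :=
  [ffun i => Ordinal (cell_index_subproof l m (tnth x i))].

Definition step m (x : d.-tuple (measurableTypeR R)) : R :=
  \sum_j F (grid_point j) * \1_(@box m j) x.

Lemma grid_pointE m (j : {ffun 'I_d -> 'I_(2 * m.+1)}) i :
  grid_point j 0 i = node l m (j i).
Proof. by rewrite !mxE /node /mesh rmorphB. Qed.

Lemma boxP m j x : cube l x -> @box m j x <-> j = box_index m x.
Proof.
move=> lx; split => [jx|-> i]; last first.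
  by rewrite /= (cellP l_gt0) ?cell_index_subproof ?ffunE.
apply/ffunP => i; apply/val_inj; rewrite ffunE /=; apply/esym/eqP.
by rewrite -(cellP l_gt0) ?ltn_ord//; exact: jx.
Qed.

Lemma box_cube m j : @box m j `<=` cube l.
Proof. by move=> x jx i; apply: cell_sub (jx i). Qed.

Lemma measurable_box m j : measurable (@box m j).
Proof.
apply: (measurable_tuple_box (A := fun i => [set` cell l m (j i)])) => i.
exact: measurable_itv.
Qed.

Lemma measurable_cube : measurable (@cube R d l).
Proof.
rewrite (_ : cube l = [set x | forall i : 'I_d, [set` `[- l, l]] (tnth x i)]).
  apply: (measurable_tuple_box (A := fun=> [set` `[- l, l]])) => i.
  exact: measurable_itv.
by apply/seteqP; split => x /= lx i; have := lx i; rewrite in_itv.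
Qed.

Lemma lebesgue_tuple_cell_box m j :
  lebesgue_tuple d (@box m j) = (mesh l m ^+ d)%:E.
Proof.
rewrite [LHS](lebesgue_tuple_prod (A := fun i => [set` cell l m (j i)])
  (a := fun=> mesh l m)).
- by rewrite prodr_const card_ord.
- by move=> i; exact: measurable_itv.
- by move=> i; exact: lebesgue_measure_cell.
Qed.

Lemma lebesgue_tuple_cube_lty : (lebesgue_tuple d (cube l) < +oo)%E.
Proof. by rewrite lebesgue_tuple_box ?ltry// => _; rewrite ge0_cp// ltW. Qed.

(** The cube has finite measure, so bounded measurable functions are
    integrable on it. *)
Lemma integrable_on_cube (f : d.-tuple (measurableTypeR R) -> R) M :
  measurable_fun (cube l) f -> (forall x, `|f x| <= M) ->
  (lebesgue_tuple d).-integrable (cube l) (EFin \o f).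
Proof.
move=> mf fM; apply: measurable_bounded_integrable => //.
- exact: measurable_cube.
- exact: lebesgue_tuple_cube_lty.
- exists M; split; first exact: num_real.
  by move=> B /ltW MB x _ /=; rewrite (le_trans (fM x)).
Qed.

Lemma step_cube m x : cube l x -> step m x = F (grid_point (box_index m x)).
Proof.
move=> lx; rewrite /step (bigD1 (box_index m x))//= big1 ?addr0.
  by rewrite indicE mem_set ?mulr1//; exact/boxP.
move=> j jx; rewrite indicE memNset ?mulr0// => /(boxP _ lx).
by move/eqP; rewrite (negbTE jx).
Qed.

Lemma measurable_step m D : measurable_fun D (step m).
Proof.
apply: measurable_sum => j; apply: measurable_funM => //.
by apply: measurable_indic; exact: measurable_box.
Qed.

(** Every box lies in the cube and has volume mesh ^ d. *)
Lemma integral_step m :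
  (\int[lebesgue_tuple d]_(x in cube l) (step m x)%:E =
  (mesh l m ^+ d *
   \sum_(j : {ffun 'I_d -> 'I_(2 * m.+1)}) F (grid_point j))%:E)%E.
Proof.
have mI j : measurable_fun (cube l) (\1_(@box m j) : _ -> R).
  by apply: measurable_indic; exact: measurable_box.
have iI j : (lebesgue_tuple d).-integrable (cube l) (EFin \o \1_(@box m j)).
  apply: (integrable_on_cube (M := 1)) => // x.
  by rewrite ger0_norm// indicE lern1 leq_b1.
under eq_integral do rewrite -sumEFin.
rewrite integral_sum; [|exact: measurable_cube|]; last first.
  move=> j; under [X in integrable _ _ X]funext do rewrite EFinM.
  by apply: integrableZl; [exact: measurable_cube|exact: iI].
rewrite mulr_sumr -sumEFin; apply: eq_bigr => j _.
under eq_integral do rewrite EFinM.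
rewrite integralZl; [|exact: measurable_cube|exact: iI].
rewrite integral_indic//; [|exact: measurable_cube|exact: measurable_box].
rewrite setIidl; last exact: box_cube.
by rewrite [X in (_ * X)%E]lebesgue_tuple_cell_box -EFinM mulrC.
Qed.

(** In each coordinate a point is within one mesh of the lower end of its
    cell, and the norm of row vectors is the maximum norm. *)
Lemma cvg_box_index x : cube l x ->
  grid_point (box_index m x) @[m --> \oo] --> row_of_tuple x.
Proof.
move=> lx; apply/cvgrPdist_le => e e0.
near=> m.
rewrite [leLHS]/Num.Def.normr/= mx_normrE; apply: bigmax_le; first exact: ltW.
move=> [i k] _ /=; rewrite (ord1 i) mxE [fun_of_matrix (- _) _ _]mxE.
rewrite grid_pointE mxE ffunE.
apply: le_trans (cell_index_dist m l_gt0 (lx k)) _.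
rewrite ler_pdivrMr// mulrC -ler_pdivrMr//.
near: m; exists (Num.truncn (l / e)) => // m /= me.
by rewrite (le_trans (ltW (truncnS_gt _)))// ler_nat.
Unshelve. all: by end_near. Qed.

Lemma compact_cube : compact [set v : 'rV[R]_d | forall i, - l <= v 0 i <= l].
Proof.
rewrite (_ : mkset _ = [set v : 'rV[R]_d | forall i, [set` `[- l, l]] (v 0 i)]).
  apply: (rV_compact (A := fun=> [set` `[- l, l]])) => _.
  exact: segment_compact.
by apply/seteqP; split => v /= lv i; have := lv i; rewrite in_itv.
Qed.

Lemma bounded_on_cube : exists M, forall v : 'rV[R]_d,
  (forall i, - l <= v 0 i <= l) -> `|F v| <= M.
Proof.
have /compact_bounded[M [_ FM]] : compact (F @`
    [set v : 'rV[R]_d | forall i, - l <= v 0 i <= l]).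
  by apply: continuous_compact compact_cube; exact: continuous_subspaceT.
by exists (M + 1) => v lv; apply: FM; [rewrite ltrDl|exists v].
Qed.

Lemma step_cvg x : cube l x -> step m x @[m --> \oo] --> F (row_of_tuple x).
Proof.
move=> lx; under eq_fun do rewrite step_cube//.
apply: continuous_cvg; [exact: F_cont|exact: cvg_box_index].
Qed.

(** Dominated convergence for the step functions, whose integrals are the
    Riemann sums; the constant bound on |F| over the cube dominates. *)
Lemma riemann_sum_cvg :
  (l / m%:R) ^+ d * \sum_(j : {ffun 'I_d -> 'I_(2 * m)}) F (grid_point j)
    @[m --> \oo] --> \int[lebesgue_tuple d]_(x in cube l) F (row_of_tuple x).
Proof.
have [M FM] := bounded_on_cube.
have stepF x : cube l x ->
    (step m x)%:E @[m --> \oo] --> (F (row_of_tuple x))%:E.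
  by move=> lx; apply: cvg_EFin; [exact: nearW|exact: step_cvg].
have mstep m : measurable_fun (cube l) (EFin \o step m).
  by apply/measurable_EFinP; exact: measurable_step.
have iM : (lebesgue_tuple d).-integrable (@cube R d l) (cst M%:E).
  exact: (@integrable_on_cube (cst M) `|M|).
(* F is measurable as a pointwise limit of step functions. *)
have mF : measurable_fun (cube l) (EFin \o (F \o @row_of_tuple R d)).
  exact: (emeasurable_fun_cvg (fun m => EFin \o step m)).
have [||iF _ cvg_int] := dominated_convergence measurable_cube mstep mF _ iM.
- by apply: aeW => x; exact: stepF.
- apply: aeW => x m lx /=; rewrite lee_fin step_cube//; apply: FM => i.
  by rewrite grid_pointE ffunE; exact: node_cell_index_sub.
pose u m := (l / m%:R) ^+ d *
  \sum_(j : {ffun 'I_d -> 'I_(2 * m)}) F (grid_point j).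
(* The step functions are indexed by m for the grid of size m + 1. *)
rewrite -/u -(cvg_shiftS u).
rewrite (_ : [sequence _]_n = fine \o fun n =>
  (\int[lebesgue_tuple d]_(x in cube l) (step n x)%:E)%E).
  apply: fine_cvg; rewrite fineK; first exact: cvg_int.
  by apply: integrable_fin_num iF; exact: measurable_cube.
by apply/funext => m /=; rewrite integral_step.
Qed.

End RiemannSum.

(** * Complex values, phases and admissible steps *)

Section ComplexRiemannSum.
Context {R : realType}.

Lemma cvg_complex (T : Type) (E : set_system T) {FE : Filter E}
    (a b : T -> R) (x y : R) :
  a t @[t --> E] --> x -> b t @[t --> E] --> y ->
  (a t +i* b t : R[i]^o) @[t --> E] --> (x +i* y : R[i]^o).
Proof.
move=> atx bty; apply/cvgrPdist_le => -[r s]; rewrite ltcE /= => /andP[/eqP -> r0].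
have r20 : 0 < r / 2 by rewrite divr_gt0.
near=> t.
have at_ : `|x - a t| <= r / 2 by near: t; exact: (cvgr_dist_le _ _ atx).
have bt : `|y - b t| <= r / 2 by near: t; exact: (cvgr_dist_le _ _ bty).
(* Two coordinates each within r / 2 are within r in modulus. *)
rewrite normc_def lecR /= (_ : r = Num.sqrt (r ^+ 2)); last by rewrite sqrtr_sqr gtr0_norm.
rewrite ler_wsqrtr//.
rewrite -[(x - _) ^+ 2]real_normK ?num_real//.
rewrite -[(y - _) ^+ 2]real_normK ?num_real//.
have ha := normr_ge0 (x - a t); have hb := normr_ge0 (y - b t).
nra.
Unshelve. all: by end_near. Qed.

Lemma sum_complex (I : finType) (a b : I -> R) :
  \sum_i (a i +i* b i) = (\sum_i a i) +i* (\sum_i b i).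
Proof. by elim/big_rec3: _ => // i x y z _ ->. Qed.

Lemma realM_expi (c t : R) : c%:C * expi t = (c * cos t) +i* (c * sin t).
Proof.
by apply/eqP; rewrite /expi eq_complex /= !mul0r subr0 addr0 !eqxx.
Qed.

Lemma continuous_phase d (l : R) (k : 'rV[int]_d) :
  continuous (fun x : 'rV[R]_d => - (2 * pi * dot (xi l k) x)).
Proof.
have dot_cont : continuous (fun x : 'rV[R]_d => dot (xi l k) x).
  apply: (continuous_big (@add_continuous _)) => i _ x.
  exact: cvgMl_tmp (@coord_continuous _ _ _ _ _ x).
by move=> x; exact: cvgN (cvgMl_tmp (dot_cont x)).
Qed.

(** The discrete Fourier phases sample the continuous ones: the factor l of
    the grid point cancels the one in the denominator of xi. *)
Lemma phase_grid_point d (l : R) (k : 'rV[int]_d) m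
    (j : {ffun 'I_d -> 'I_(2 * m)}) : 0 < l -> (0 < m)%N ->
  dot (xi l k) (grid_point l j) = (dot k (centered j))%:~R / (2 * m)%:R.
Proof.
move=> l0 m0; rewrite /dot rmorph_sum mulr_suml; apply: eq_bigr => i _.
rewrite /grid_point /xi !mxE rmorphM natrM /=. field.
by rewrite pnatr_eq0 -lt0n m0 gt_eqF.
Qed.

(** An admissible step is positive and l / h is an integer, so that truncating
    l / h loses nothing. *)
Lemma admissible_meshE (l h : R) : 0 < l -> admissible_mesh l h ->
  [/\ 0 < h, (0 < Num.truncn (l / h))%N & h = l / (Num.truncn (l / h))%:R].
Proof.
move=> l0 [[m0 m00 hE] [m lhE]].
have h0 : 0 < h by rewrite hE invr_gt0 ltr0n.
have lh0 : 0 < l / h by rewrite divr_gt0.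
rewrite lhE natrK -lhE invf_div mulrC divfK ?gt_eqF//; split => //.
by rewrite -(ltr0n R) -lhE.
Qed.

Lemma cvg_truncn_mesh (l : R) : 0 < l ->
  Num.truncn (l / h) @[h --> within (admissible_mesh l) (nbhs (0 : R))] --> \oo.
Proof.
move=> l0; apply/cvgnyPge => N; have [->|N0] := posnP N; first exact: nearW.
rewrite near_withinE; near=> h => adm; have [h0 _ _] := admissible_meshE l0 adm.
rewrite truncn_ge_nat; last by rewrite divr_ge0// ltW.
rewrite ler_pdivlMr// mulrC -ler_pdivlMr ?ltr0n//.
rewrite -[h]ger0_norm ?(ltW h0)// -normrN -[- h]add0r.
near: h; apply: cvgr_dist_le; first exact: cvg_id.
by rewrite divr_gt0// ltr0n.
Unshelve. all: by end_near. Qed.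

End ComplexRiemannSum.

(** * Convergence of the eigenvalues *)

Theorem theorem3p1 (R : realType) (d : nat) (rho : 'rV[R]_d -> R) (l : R)
    (k : 'rV[int]_d)
    (d_ge1 : (1 <= d)%N)
    (rho_cont : continuous rho)
    (rho_cov : stationary_covariance rho)
    (rho_abs : forall x : 'rV[R]_d, rho x = rho (map_mx Num.norm x))
    (l_ge1 : 1 <= l) :
  (h0 ^+ d)%:C * Lambda_ext rho h0 l k
    @[h0 --> within (admissible_mesh l) (nbhs (0 : R))]
    --> (lambda_ext rho l k : R[i]^o).
Proof.
have l0 : 0 < l by rewrite (lt_le_trans ltr01).
pose theta (x : 'rV[R]_d) := - (2 * pi * dot (xi l k) x).
pose Fcos x := rho x * cos (theta x).
pose Fsin x := rho x * sin (theta x).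
have cont_theta : continuous theta by exact: continuous_phase.
have cont_cos : continuous Fcos.
  move=> x; apply: (cvgM (rho_cont x)).
  by apply: continuous_cvg; [exact: continuous_cos|exact: cont_theta].
have cont_sin : continuous Fsin.
  move=> x; apply: (cvgM (rho_cont x)).
  by apply: continuous_cvg; [exact: continuous_sin|exact: cont_theta].
pose S (F : 'rV[R]_d -> R) m : R := (l / m%:R) ^+ d *
  \sum_(j : {ffun 'I_d -> 'I_(2 * m)}) F (grid_point l j).
have cvgS F : continuous F ->
    S F (Num.truncn (l / h)) @[h --> within (admissible_mesh l) (nbhs (0 : R))]
    --> \int[lebesgue_tuple d]_(x in cube l) F (row_of_tuple x).
  move=> cF; exact: cvg_comp (cvg_truncn_mesh l0) (riemann_sum_cvg l0 cF).
have -> : lambda_ext rho l k =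
    (\int[lebesgue_tuple d]_(x in cube l) Fcos (row_of_tuple x)) +i*
    (\int[lebesgue_tuple d]_(x in cube l) Fsin (row_of_tuple x)).
  rewrite /lambda_ext /cube_integral.
  by congr (_ +i* _); apply: eq_Rintegral => x _; rewrite realM_expi.
apply: cvg_trans (cvg_complex (cvgS _ cont_cos) (cvgS _ cont_sin)).
(* Along admissible steps the weighted eigenvalue is the Riemann sum. *)
apply: near_eq_cvg; rewrite near_withinE; apply: nearW => h adm.
have [h0 m0 hE] := admissible_meshE l0 adm.
rewrite /Lambda_ext /S; move: m0 hE; set m := Num.truncn _ => m0 hE.
have -> : h ^+ d = (l / m%:R) ^+ d by rewrite hE.
rewrite (eq_bigr (fun j => Fcos (grid_point l j) +i* Fsin (grid_point l j))).
  rewrite sum_complex; apply/eqP; rewrite eq_complex /=.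
  by rewrite !mul0r subr0 addr0 !eqxx.
move=> j _ /=; rewrite realM_expi -(phase_grid_point k _ l0 m0).
by rewrite /Fcos /Fsin /theta /grid_point -hE.
Qed.
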